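(* For $C>0$, define $\mathcal R_C=\{(x,y)\in\mathbb R^2:|x|\le C/\sqrt2\text{ or }|y|\le C/\sqrt2\}$. Let $\Sigma\subset\mathbb R^2$ be a damping set such that $\Sigma\subset\mathcal R_C$ for some $C>0$. Then, for every $p\in[1,+\infty)$ and every decreasing function $\varphi:\mathbb R_+\to(0,+\infty)$ tending to $0$ as $t\to+\infty$, there exists $(z_0,z_1)\in\mathsf X_p$ such that every solution $z$ in $\mathsf X_p$ of the wave equation associated with $\Sigma$ with initial condition $(z_0,z_1)$ satisfies, for every $t\ge0$, $$e_p(z)(t)\ge\varphi(t).$$
   Context: Notation: $\mathbb R_+=[0,+\infty)$, $R=\begin{pmatrix}\frac1{\sqrt2}&\frac1{\sqrt2}\\-\frac1{\sqrt2}&\frac1{\sqrt2}\end{pmatrix}$ and $R\Sigma=\{R\xi:\xi\in\Sigma\}$. $L^p_{\mathrm{loc}}(a,+\infty)$ is the set of measurable functions whose restriction to $(a,T)$ is in $L^p$ for every $T>a$. $W^{1,p}_*(0,1)=\{u\in L^p(0,1): u'\in L^p(0,1),\ u(0)=0\}$ and $\mathsf X_p=W^{1,p}_*(0,1)\times L^p(0,1)$, with norm $\|(u,v)\|_{\mathsf X_p}^p=2^{-p/2}\int_0^1(|u'+v|^p+|u'-v|^p)\,dx$ for $p<+\infty$. The wave equation associated with $\Sigma$ is: $z_{tt}=z_{xx}$ on $\mathbb R_+\times[0,1]$; $z(t,0)=0$ and $(z_t(t,1),-z_x(t,1))\in\Sigma$ for $t\in\mathbb R_+$; $z(0,x)=z_0(x)$,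 $z_t(0,x)=z_1(x)$ for $x\in[0,1]$. A (weak, global in time) solution in $\mathsf X_p$ with initial condition $(z_0,z_1)\in\mathsf X_p$ is a function $z:\mathbb R_+\times[0,1]\to\mathbb R$ for which there exist $f\in L^p_{\mathrm{loc}}(0,+\infty)$ and $g\in L^p_{\mathrm{loc}}(-1,+\infty)$ such that $z(t,x)=\frac1{\sqrt2}\int_0^{t+x}f+\frac1{\sqrt2}\int_0^{t-x}g$ for all $(t,x)\in\mathbb R_+\times[0,1]$, $z(t,0)=0$ and $(z_t(t,1),-z_x(t,1))\in\Sigma$ for a.e. $t\in\mathbb R_+$, and $z(0,x)=z_0(x)$, $z_t(0,x)=z_1(x)$ for a.e. $x\in[0,1]$; here $z_t(t,x)=\frac{f(t+x)+g(t-x)}{\sqrt2}$ and $z_x(t,x)=\frac{f(t+x)-g(t-x)}{\sqrt2}$. Set $e_p(z)(t)=\|(z(t,\cdot),z_t(t,\cdot))\|_{\mathsf X_p}$. Damping set: $\Sigma$ is a damping set if $(0,0)\in\Sigma$, $xy\ge0$ for every $(x,y)\in\Sigma$, and $R\Sigma$ contains the graph of a universally measurable function $\phi:\mathbb R\to\mathbb R$ with linear growth ($|\phi(x)|\le a|x|+b$ for some $a,b\ge0$). A set $M\subset\mathbb R$ is universally measurable if for every Borel probability measure $\nu$ on $\mathbb R$ there exist Borel sets $A\subset M\subset B$ with $\nu(B\setminus A)=0$; $\phi$ is universally measurable if preimages of Borel sets are universally measurable. *)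

(* Defs.v *)
From HB Require Import structures.
From mathcomp Require Import all_boot all_order all_algebra.
From mathcomp Require Import all_classical all_reals all_analysis.

Set Implicit Arguments.
Unset Strict Implicit.
Unset Printing Implicit Defensive.

Import Order.TTheory GRing.Theory Num.Theory.
Import numFieldNormedType.Exports.

Local Open Scope classical_set_scope.
Local Open Scope ring_scope.

Section function_spaces.
Context {R : realType}.
Implicit Types (p a b : R) (D : set R) (f u v w h : R -> R).

Local Notation mu := (@lebesgue_measure R).

(* Measurability on R is Borel measurability: elements of L^p are equivalence
   classes modulo a.e. equality, each of which has a Borel representative. *)
Definition in_Lp p D f : Prop := (f \_ D) \in Lfun mu p%:E.

Definition in_Lp_loc p a f : Prop :=
  forall T, a < T -> in_Lp p `]a, T[ f.

Definition int_from_to f a b : R :=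
  if a <= b then \int[mu]_(x in `[a, b]) f x
  else - \int[mu]_(x in `[b, a]) f x.

(* C^1 functions with compact support in (0,1). *)
Definition test_function h : Prop :=
  [/\ forall x : R, derivable h x 1,
      continuous (derive1 h) &
      closure [set x | h x != 0] `<=` `]0, 1[].

Definition is_weak_derivative u w : Prop :=
  [/\ locally_integrable `]0, 1[ u,
      locally_integrable `]0, 1[ w &
      forall h, test_function h ->
        \int[mu]_(x in `]0, 1[) (u x * derive1 h x) =
        - \int[mu]_(x in `]0, 1[) (w x * h x)].

(* A representative of u' (unique up to a.e. equality on (0,1)), with junk
   value 0 if u has no weak derivative. *)
Definition weak_derivative u : R -> R :=
  xget (cst 0) [set w | is_weak_derivative u w].

(* u(0) = 0 for the continuous representative of the class of u. *)
Definition vanishes_at_0 u : Prop :=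
  exists c : R -> R,
    [/\ {within `[0, 1], continuous c},
        {ae mu, forall x, x \in `]0, 1[ -> u x = c x} &
        c 0 = 0].

Definition in_W1p_star p u : Prop :=
  [/\ in_Lp p `]0, 1[ u,
      exists2 w, is_weak_derivative u w & in_Lp p `]0, 1[ w &
      vanishes_at_0 u].

Definition in_X p u v : Prop := in_W1p_star p u /\ in_Lp p `]0, 1[ v.

Definition X_norm p u v : R :=
  (2 `^ (- (p / 2)) *
   \int[mu]_(x in `]0, 1[) (`|weak_derivative u x + v x| `^ p +
                            `|weak_derivative u x - v x| `^ p)) `^ p^-1.

End function_spaces.

Section damping.
Context {R : realType}.
Implicit Types (Sigma : set (R * R)) (phi : R -> R).

Definition universally_measurable_set (M : set R) : Prop :=
  forall nu : probability (measurableTypeR R) R,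
  exists A B : set (measurableTypeR R),
    [/\ measurable A, measurable B, A `<=` M, M `<=` B & nu (B `\` A) = 0%E].

Definition universally_measurable phi : Prop :=
  forall Y : set (measurableTypeR R), measurable Y ->
    universally_measurable_set (phi @^-1` Y).

Definition linear_growth phi : Prop :=
  exists a b : R, [/\ 0 <= a, 0 <= b & forall x, `|phi x| <= a * `|x| + b].

(* Multiplication by the matrix of the rotation of angle -pi/4. *)
Definition rotR (xi : R * R) : R * R :=
  ((Num.sqrt 2)^-1 * xi.1 + (Num.sqrt 2)^-1 * xi.2,
   - (Num.sqrt 2)^-1 * xi.1 + (Num.sqrt 2)^-1 * xi.2).

Definition damping_set Sigma : Prop :=
  [/\ Sigma (0, 0),
      forall x y, Sigma (x, y) -> 0 <= x * y &
      exists phi, [/\ universally_measurable phi, linear_growth phi &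
                      [set (x, phi x) | x in setT] `<=` rotR @` Sigma]].

Definition cross_region (C : R) : set (R * R) :=
  [set xy | `|xy.1| <= C / Num.sqrt 2 \/ `|xy.2| <= C / Num.sqrt 2].

End damping.

Section wave_equation.
Context {R : realType}.
Implicit Types (p t x : R) (Sigma : set (R * R)) (f g : R -> R)
  (z : R -> R -> R).

Local Notation mu := (@lebesgue_measure R).

Definition wave_t f g t x : R := (f (t + x) + g (t - x)) / Num.sqrt 2.

Definition wave_x f g t x : R := (f (t + x) - g (t - x)) / Num.sqrt 2.

(* z is a solution in X_p, with travelling waves f and g as witnesses; they are
   kept as arguments since z_t and z_x are defined from them. The values of z
   outside [0, +oo) x [0, 1] are irrelevant. *)
Definition wave_solution p Sigma (z0 z1 : R -> R) z f g : Prop :=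
  [/\ in_Lp_loc p 0 f,
      in_Lp_loc p (-1) g,
      forall t x, 0 <= t -> 0 <= x <= 1 ->
        z t x = (Num.sqrt 2)^-1 * int_from_to f 0 (t + x) +
                (Num.sqrt 2)^-1 * int_from_to g 0 (t - x),
      {ae mu, forall t, 0 <= t ->
        z t 0 = 0 /\ Sigma (wave_t f g t 1, - wave_x f g t 1)} &
      {ae mu, forall x, 0 <= x <= 1 ->
        z 0 x = z0 x /\ wave_t f g 0 x = z1 x}].

Definition energy p z f g t : R := X_norm p (z t) (wave_t f g t).

End wave_equation.

(* Main.v *)
Require Import Defs.
From HB Require Import structures.
From mathcomp Require Import all_boot all_order all_algebra.
From mathcomp Require Import all_classical all_reals all_analysis.
From mathcomp Require Import measurable_realfun ring lra.

Set Implicit Arguments.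
Unset Strict Implicit.
Unset Printing Implicit Defensive.

Import Order.TTheory GRing.Theory Num.Theory.
Import numFieldNormedType.Exports.

Local Open Scope classical_set_scope.
Local Open Scope ring_scope.

(** A solution is a superposition of two travelling waves [f (t + x)] and
    [g (t - x)]. The condition at [x = 0] forces [f = - g] on the positive half-line,
    so a single function [g] on [(-1, +oo)] describes the solution, and the condition
    at [x = 1] relates [g (t + 1)] to [g (t - 1)]. In these terms the [p]-th power of
    the energy at time [t] is the integral of [|g| ^ p] over [(t - 1, t + 1)]
    ([energyE]).

    Since the boundary states stay in the cross-shaped region, each reflection
    decreases [|g|] by at most the additive constant [C]
    ([cross_region_reflection]). Therefore [|g (2 m + y)| >= |g y| - m C]: bounded
    data may be dissipated in finite time, but an unbounded initial wave is only
    truncated at the slowly moving level [m C]. The mass of an [Lp] function above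
    the level [m C] tends to [0] as slowly as one likes if the function is
    sufficiently singular; [slow_profile] builds such a function [G] from narrow
    and high plateaus at the origin. The data [z0 = 0], [z1 = sqrt 2 * G] give an
    initial wave with [|g y| = G |y|] on [(-1, 1)], and [energy_lower_bound] follows
    this singularity around the domain. The argument applies to every solution and
    does not require solving the equation.

    The energy is defined with an unspecified weak derivative of [z t]. That [z_x] is
    a weak derivative follows by exchanging two
    integrals ([is_weak_derivative_primitive]); that all weak derivatives agree
    almost everywhere is the lemma of du Bois-Reymond ([du_bois_reymond]). The other
    analytic ingredient is that a function whose primitive is constant vanishes
    almost everywhere ([ae_eq0_primitive]); it is used for the uniqueness of weak
    derivatives and to read off the two waves from the values of [z]. *)

(** * Changes of variable preserving Lebesgue measure *)

Section ae_filter.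
Context {R : realType}.

(* The carrier of [lebesgue_measure] hides the filter structure of its almost
   everywhere sets from inference. *)
#[global] Instance lebesgue_ae_filter :
  Filter (nbhs (almost_everywhere (@lebesgue_measure R))) :=
  ae_filter_ringOfSetsType (@lebesgue_measure R).

End ae_filter.

Section measure_preserving.
Context {R : realType}.
Local Notation mu := (@lebesgue_measure R).
Implicit Types (T : R -> R) (k : R -> R).

Definition measure_preserving T : Prop :=
  measurable_fun setT T /\
  forall A : set (measurableTypeR R), measurable A -> mu (T @^-1` A) = mu A.

(** The image of Lebesgue measure and Lebesgue measure itself agree on half-open
    intervals, which determine a measure; for a reflection the closed endpoint
    changes side, which does not affect lengths. *)
Lemma measure_preserving_shift (a : R) : measure_preserving (fun x => a + x).
Proof.
have mT : measurable_fun setT (fun x : R => a + x) by exact: measurable_funD.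
split=> // A mA.
have : pushforward mu (fun x : R => a + x : measurableTypeR R) A = mu A.
  apply/esym/lebesgue_measure_unique => //= _ [[b c]] _ <-.
  rewrite /pushforward.
  rewrite (_ : _ @^-1` _ = `](b - a), (c - a)]%classic); last first.
    by apply/seteqP; split => x /=; rewrite !in_itv/= => /andP[? ?];
      apply/andP; split; lra.
  rewrite !lebesgue_measure_itv/= !lte_fin ltrD2r.
  by case: ifP => // _; rewrite -!EFinD; congr EFin; ring.
by [].
Qed.

Lemma measure_preserving_reflection (a : R) :
  measure_preserving (fun x => a - x).
Proof.
have mT : measurable_fun setT (fun x : R => a - x) by exact: measurable_funB.
split=> // A mA.
have : pushforward mu (fun x : R => a - x : measurableTypeR R) A = mu A.
  apply/esym/lebesgue_measure_unique => //= _ [[b c]] _ <-.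
  rewrite /pushforward.
  rewrite (_ : _ @^-1` _ = `[(a - c), (a - b)[%classic); last first.
    by apply/seteqP; split => x /=; rewrite !in_itv/= => /andP[? ?];
      apply/andP; split; lra.
  rewrite !lebesgue_measure_itv/= !lte_fin ltrD2l ltrN2.
  by case: ifP => // _; rewrite -!EFinD; congr EFin; ring.
by [].
Qed.

Lemma ae_comp T (P : R -> Prop) : measure_preserving T ->
  {ae mu, forall x, P x} -> {ae mu, forall x, P (T x)}.
Proof.
move=> [mT pT] [N [mN N0 PN]]; exists (T @^-1` N); split.
- by rewrite -[X in measurable X]setTI; exact: mT.
- by rewrite pT.
- by move=> x /= nP; apply: PN.
Qed.

Lemma integrable_comp T k : measure_preserving T ->
  mu.-integrable setT (EFin \o k) -> mu.-integrable setT (EFin \o (k \o T)).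
Proof.
move=> [mT pT] /integrableP[mk ik]; apply/integrableP; split.
  exact: (measurableT_comp mk mT).
apply: le_lt_trans ik.
rewrite (_ : (\int[mu]_x _)%E =
    \int[mu]_(x in T @^-1` setT) ((fun y => `|(EFin \o k) y|) \o T) x)%E //.
rewrite -(@ge0_integral_pushforward _ _ (measurableTypeR R) (measurableTypeR R) R
  T mT mu setT)//.
- by rewrite le_eqVlt; apply/orP; left; apply/eqP;
    apply: eq_measure_integral => A mA _; exact: pT.
- exact: (measurableT_comp (@abse_measurable R setT) mk).
Qed.

Lemma Rintegral_comp T k : measure_preserving T ->
  mu.-integrable setT (EFin \o k) ->
  (\int[mu]_x k (T x) = \int[mu]_x k x)%R.
Proof.
move=> pT ik; rewrite /Rintegral; congr fine.
have [mT mpT] := pT.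
rewrite [LHS](_ : _ = \int[mu]_(x in T @^-1` setT) ((EFin \o k) \o T) x)%E //.
rewrite -(@integral_pushforward _ _ (measurableTypeR R) (measurableTypeR R) R
  T mT mu setT (EFin \o k))//.
- by apply: eq_measure_integral => A mA _; exact: mpT.
- exact: measurable_int ik.
- exact: integrable_comp.
Qed.

End measure_preserving.

(** * Primitives of integrable functions *)

Section primitive.
Context {R : realType}.
Local Notation mu := (@lebesgue_measure R).
Implicit Types (k : R -> R) (a b x : R) (P : R -> Prop).

Definition primitive k x : R := \int[mu]_(y in `]-oo, x]) k y.

Lemma ae_itv_ex P a b : a < b -> {ae mu, forall x, P x} ->
  exists2 x, a < x < b & P x.
Proof.
move=> ab [N [mN N0 PN]]; have [//|nP] := pselect (exists2 x, a < x < b & P x).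
have : (mu `]a, b[ <= mu N)%E.
  apply: le_measure; [by rewrite inE; exact: measurable_itv|by rewrite inE|].
  move=> x /=; rewrite in_itv/= => xab; apply: PN => Px.
  by apply: nP; exists x.
by rewrite N0 lebesgue_measure_itv/= lte_fin ab -EFinB lee_fin leNgt subr_gt0 ab.
Qed.

(** At almost every point the primitive has derivative [k x]; were that nonzero
    where the primitive takes the value [c], the primitive would avoid [c] at all
    nearby points, whereas it takes that value on a dense set. *)
Lemma ae_eq0_primitive k a b c : mu.-integrable setT (EFin \o k) ->
  {ae mu, forall x, a < x < b -> primitive k x = c} ->
  {ae mu, forall x, a < x < b -> k x = 0}.
Proof.
move=> ik F0.
have dF : {ae mu, forall x, derivable (primitive k) x 1 /\
                            derive1 (primitive k) x = k x}.
  apply: FTC1Ny.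
  - by move=> y; exact: (integrableS measurableT).
  - exact: open_integrable_locally openT ik.
apply: filterS2 (F0) dF => x /= Fx0 [dFx kx] xab; apply: contrapT => /eqP kx0.
have cF : h^-1 *: (primitive k (h + x) - primitive k x) @[h --> 0^'] --> k x.
  rewrite -kx; move: dFx; rewrite /derivable /derive1.
  set d := (fun _ : R => _); set d' := (fun _ : R => _).
  suff -> : d = d' by [].
  by rewrite funeqE => h; rewrite /d /d' /= [h%:A]mulr1.
have [e /= e0 He] := cvgr_neq0 _ cF kx0.
have [ax xb] := andP xab.
have [y /andP[xy ye] Fy0] : exists2 y, x < y < Num.min b (x + e) &
    (a < y < b -> primitive k y = c).
  by apply: ae_itv_ex; [rewrite lt_min xb ltrDl|exact: F0].
move: ye; rewrite lt_min => /andP[yb ye].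
have : (y - x)^-1 *: (primitive k (y - x + x) - primitive k x) != 0.
  apply: He; last by rewrite subr_eq0 gt_eqF.
  by rewrite /ball_/= sub0r normrN gtr0_norm ?subr_gt0// ltrBlDl.
by rewrite subrK Fy0 ?(lt_trans ax)//= Fx0// subrr scaler0 eqxx.
Qed.

Lemma integrable_itv k (i : interval R) : mu.-integrable setT (EFin \o k) ->
  mu.-integrable [set` i] (EFin \o k).
Proof. by move=> ik; apply: (integrableS measurableT). Qed.

Lemma primitiveD k m x : mu.-integrable setT (EFin \o k) ->
  mu.-integrable setT (EFin \o m) ->
  primitive (fun y => k y + m y) x = primitive k x + primitive m x.
Proof.
by move=> ik im; rewrite /primitive RintegralD//; exact: integrable_itv.
Qed.

Lemma primitiveB k m x : mu.-integrable setT (EFin \o k) ->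
  mu.-integrable setT (EFin \o m) ->
  primitive (fun y => k y - m y) x = primitive k x - primitive m x.
Proof.
by move=> ik im; rewrite /primitive RintegralB//; exact: integrable_itv.
Qed.

Lemma primitiveZ k r x : mu.-integrable setT (EFin \o k) ->
  primitive (fun y => r * k y) x = r * primitive k x.
Proof. by move=> ik; rewrite /primitive RintegralZl//; exact: integrable_itv. Qed.

Lemma integrable_restrict_itv k (i : interval R) :
  mu.-integrable [set` i] (EFin \o k) ->
  mu.-integrable setT (EFin \o (k \_ [set` i])).
Proof.
by move/integrable_mkcond; rewrite -restrict_EFin; apply; exact: measurable_itv.
Qed.

Lemma primitive_shift k t x : mu.-integrable setT (EFin \o k) ->
  primitive (fun y => k (t + y)) x = primitive k (t + x).
Proof.
move=> ik; rewrite /primitive [RHS]Rintegral_mkcond.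
rewrite -(Rintegral_comp (measure_preserving_shift t)); last first.
  exact/integrable_restrict_itv/integrable_itv.
rewrite Rintegral_mkcond; apply: eq_Rintegral => y _.
by rewrite !patchE !mem_setE !in_itv/= lerD2l.
Qed.

Lemma primitive_reflection k t x : mu.-integrable setT (EFin \o k) ->
  primitive (fun y => k (t - y)) x = \int[mu]_y k y - primitive k (t - x).
Proof.
move=> ik; have -> : \int[mu]_y k y - primitive k (t - x) =
    \int[mu]_(y in `[t - x, +oo[) k y.
  rewrite -Rintegral_itv_obnd_cbnd; last exact: integrable_itv.
  rewrite -set_itvNyy -(@Rintegral_itvB _ _ -oo%O +oo%O (t - x))//.
  exact: integrable_itv.
rewrite /primitive [RHS]Rintegral_mkcond.
rewrite -(Rintegral_comp (measure_preserving_reflection t)); last first.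
  exact/integrable_restrict_itv/integrable_itv.
rewrite Rintegral_mkcond; apply: eq_Rintegral => y _.
by rewrite !patchE !mem_setE !in_itv/= andbT lerD2l lerN2.
Qed.

(** Only the values strictly between the bounds matter, so [k] may be a truncation
    of [f] that makes it integrable on the line. *)
Lemma int_from_toE f k a b : mu.-integrable setT (EFin \o k) ->
  (forall x, Num.min a b < x < Num.max a b -> f x = k x) ->
  int_from_to f a b = primitive k b - primitive k a.
Proof.
move=> ik.
suff H c d : c <= d -> (forall x, c < x < d -> f x = k x) ->
    \int[mu]_(x in `[c, d]) f x = primitive k d - primitive k c.
  rewrite /int_from_to; have [ab|/ltW ab] := leP a b => fk.
    by apply: H => //; apply: fk.
  by rewrite H// opprB.
move=> cd fk.
have ifcd : mu.-integrable `]c, d[ (EFin \o f).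
  apply: eq_integrable (integrable_itv `]c, d[ ik) => // x.
  by rewrite inE/= in_itv/= => /fk ->.
move: cd; rewrite le_eqVlt => /orP[/eqP->|cd].
  by rewrite set_itv1 Rintegral_set1 subrr.
rewrite /primitive Rintegral_itvB//; last 2 first.
- exact: integrable_itv.
- by rewrite bnd_simp ltW.
rewrite /Rintegral; congr fine.
rewrite integral_itv_bndoo; last exact: (measurable_int mu ifcd).
rewrite [RHS]integral_itv_bndoo; last first.
  exact: (measurable_int mu (integrable_itv `]c, d[ ik)).
by apply: eq_integral => x; rewrite inE/= in_itv/= => /fk ->.
Qed.

End primitive.

Section primitive_fubini.
Context {R : realType}.
Local Notation mu := (@lebesgue_measure R).
Implicit Types (m k : R -> R).

Let triangle m k (xy : measurableTypeR R * measurableTypeR R) : \bar R :=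
  (if xy.2 <= xy.1 then m xy.1 * k xy.2 else 0)%:E.

Let measurable_triangle m k :
  mu.-integrable setT (EFin \o m) -> mu.-integrable setT (EFin \o k) ->
  measurable_fun setT (triangle m k).
Proof.
move=> /measurable_int/measurable_EFinP mm /measurable_int/measurable_EFinP mk.
apply/measurable_EFinP; apply: measurable_fun_ifT.
- by apply: measurable_fun_ler; [exact: measurable_snd|exact: measurable_fst].
- apply: measurable_funM.
  + exact: (measurableT_comp mm measurable_fst).
  + exact: (measurableT_comp mk measurable_snd).
- exact: measurable_cst.
Qed.

Let integrable_triangle m k :
  mu.-integrable setT (EFin \o m) -> mu.-integrable setT (EFin \o k) ->
  (mu \x mu)%E.-integrable setT (triangle m k).
Proof.
move=> im ik; apply/integrable12ltyP; first exact: measurable_triangle.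
have [mm iim] := integrableP _ _ _ im; have [mk iik] := integrableP _ _ _ ik.
apply: (@le_lt_trans _ _ (\int[mu]_x (`|m x|%:E * \int[mu]_y `|(k y)%:E|))%E).
  apply: ge0_le_integral => //.
  - by move=> x _; exact: integral_ge0.
  - apply: (measurable_fun_fubini_tonelli_F (fun xy => `|triangle m k xy|%E)) => //.
    exact: (measurableT_comp (@abse_measurable R setT) (measurable_triangle im ik)).
  - apply: emeasurable_funM => //.
    apply/measurable_EFinP; apply: measurableT_comp => //.
    exact/measurable_EFinP.
  move=> x _; rewrite -ge0_integralZl//; last exact: measurableT_comp.
  apply: ge0_le_integral => //.
  - apply: (measurable_fun_pair2 (f := fun xy => `|triangle m k xy|%E)).
    exact: (measurableT_comp (@abse_measurable R setT) (measurable_triangle im ik)).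
  - by apply: emeasurable_funM => //; exact: measurableT_comp.
  - move=> y _; rewrite /triangle/=; case: ifPn => _.
      by rewrite normrM EFinM.
    by rewrite normr0 mule_ge0.
rewrite ge0_integralZr//.
- by rewrite lte_mul_pinfty ?integral_ge0// ge0_fin_numE// integral_ge0.
- apply/measurable_EFinP; apply: measurableT_comp => //.
  exact/measurable_EFinP.
- exact: integral_ge0.
Qed.

Let triangleE1 m k x : mu.-integrable setT (EFin \o k) ->
  (\int[mu]_y triangle m k (x, y) = (m x * primitive k x)%:E)%E.
Proof.
move=> ik.
have ikx : mu.-integrable `]-oo, x] (EFin \o k) by exact: (integrableS measurableT).
transitivity (\int[mu]_(y in `]-oo, x]) ((m x)%:E * (k y)%:E))%E.
  rewrite [RHS]integral_mkcond; apply: eq_integral => y _.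
  rewrite /triangle patchE/= mem_setE in_itv/=.
  by case: ifPn => // _; rewrite EFinM.
rewrite integralZl// EFinM; congr (_ * _)%E.
by rewrite fineK//; exact: integrable_fin_num.
Qed.

Let triangleE2 m k y : mu.-integrable setT (EFin \o m) ->
  (\int[mu]_x triangle m k (x, y) =
   (k y * \int[mu]_(x in `[y, +oo[) m x)%:E)%E.
Proof.
move=> im.
have imy : mu.-integrable `[y, +oo[ (EFin \o m) by exact: (integrableS measurableT).
transitivity (\int[mu]_(x in `[y, +oo[) ((k y)%:E * (m x)%:E))%E.
  rewrite [RHS]integral_mkcond; apply: eq_integral => x _.
  rewrite /triangle patchE/= mem_setE in_itv/= andbT.
  by case: ifPn => // _; rewrite -EFinM mulrC.
rewrite integralZl// EFinM; congr (_ * _)%E.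
by rewrite fineK//; exact: integrable_fin_num.
Qed.

Lemma integrable_mul_primitive m k :
  mu.-integrable setT (EFin \o m) -> mu.-integrable setT (EFin \o k) ->
  mu.-integrable setT (fun x => (m x * primitive k x)%:E).
Proof.
move=> im ik; have := integrable_fubini_F (integrable_triangle im ik).
by apply: eq_integrable => // x _; rewrite /fubini_F triangleE1.
Qed.

(** Both sides are the double integral of [m x * k y] over the half-plane
    [y <= x]; this replaces integration by parts, which is not available when
    the primitive is merely absolutely continuous. *)
Lemma Rintegral_mul_primitive m k :
  mu.-integrable setT (EFin \o m) -> mu.-integrable setT (EFin \o k) ->
  (\int[mu]_x (m x * primitive k x) =
   \int[mu]_y (k y * \int[mu]_(x in `[y, +oo[) m x))%R.
Proof.
move=> im ik; rewrite /Rintegral; congr fine.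
transitivity (\int[mu]_x \int[mu]_y triangle m k (x, y))%E.
  by apply: eq_integral => x _; rewrite triangleE1.
rewrite Fubini; last exact: integrable_triangle.
by apply: eq_integral => y _; rewrite triangleE2.
Qed.

End primitive_fubini.

(** * Weak derivatives on the unit interval *)

Section weak_derivative_existence.
Context {R : realType}.
Local Notation mu := (@lebesgue_measure R).
Implicit Types (h k u : R -> R) (a b c x : R).

Lemma test_function_continuous h : test_function h -> continuous h.
Proof.
by move=> [dh _ _] x; apply/differentiable_continuous/derivable1_diffP/dh.
Qed.

Lemma test_function_eq0 h x : test_function h -> ~ (0 < x < 1) -> h x = 0.
Proof.
move=> [_ _ sh] nx; apply: contrapT => /eqP hx; apply: nx.
by have := sh x (@subset_closure _ [set y | h y != 0] x hx); rewrite /= in_itv.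
Qed.

Lemma integrable_mul_test k h (D : set (measurableTypeR R)) : measurable D ->
  mu.-integrable D (EFin \o k) -> test_function h ->
  mu.-integrable D (fun x => (k x * h x)%:E).
Proof.
move=> mD ik Th; have ch := test_function_continuous Th.
have ch01 : {within `[0, 1], continuous h} by exact: continuous_subspaceT.
have [M [_ HM]] := compact_bounded (continuous_compact ch01
  (@segment_compact _ 0 1)).
apply: eq_integrable (integrableMl mD ik (h := h) _ _) => //.
  by apply: measurable_funTS; exact: continuous_measurable_fun.
exists `|M|; split; first exact: num_real.
move=> N MN x _ /=.
have [x01|x01] := boolP (0 <= x <= 1).
  by apply: HM; [exact: le_lt_trans (ler_norm _) MN|exists x].
rewrite (test_function_eq0 Th) ?normr0 ?(le_trans (normr_ge0 M) (ltW MN))//.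
by move=> /andP[x0 x1]; move: x01; rewrite !ltW.
Qed.

Lemma integrable_derive_test h : test_function h ->
  mu.-integrable setT (EFin \o (derive1 h \_ `]0, 1[)).
Proof.
move=> [_ ch _]; rewrite -restrict_EFin.
have i01 : mu.-integrable `]0, 1[ (EFin \o derive1 h).
  have i01 : mu.-integrable `[0, 1] (EFin \o derive1 h).
    apply: continuous_compact_integrable; first exact: segment_compact.
    exact: continuous_subspaceT.
  apply: integrableS i01 => //; exact: subset_itv_oo_cc.
by move/integrable_mkcond : i01; apply.
Qed.

Lemma Rintegral_derive_test h a b : test_function h -> a <= b ->
  \int[mu]_(x in `[a, b]) derive1 h x = h b - h a.
Proof.
move=> Th; have [dh ch _] := Th; rewrite le_eqVlt => /orP[/eqP <-|ab].
  by rewrite set_itv1 Rintegral_set1 subrr.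
have FTC : (\int[mu]_(x in `[a, b]) (derive1 h x)%:E = (h b)%:E - (h a)%:E)%E.
  apply: (@continuous_FTC2 _ (derive1 h) h _ _ ab); last by move=> x _.
  - exact: continuous_subspaceT.
  - split; first by move=> x _; exact: dh.
    + by apply: cvg_at_right_filter; exact: test_function_continuous.
    + by apply: cvg_at_left_filter; exact: test_function_continuous.
by rewrite /Rintegral FTC.
Qed.

(** A test function vanishes to the right of the interval, hence is recovered from
    its derivative by integrating over a half-line. This is the form that the
    exchange of integrals produces. *)
Lemma Rintegral_derive_test_tail h y : test_function h ->
  \int[mu]_(x in `[y, +oo[) (derive1 h \_ `]0, 1[) x = - h y.
Proof.
move=> Th; have h0 := test_function_eq0 (x := _) Th.
have ih a b : mu.-integrable `[a, b] (EFin \o derive1 h).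
  apply: continuous_compact_integrable; first exact: segment_compact.
  by apply: continuous_subspaceT; case: Th.
rewrite -Rintegral_mkcondr.
have [y1|y1] := leP 1 y.
  rewrite (_ : _ `&` _ = set0) ?Rintegral_set0 ?h0 ?oppr0//.
    by apply/negP; rewrite negb_and -!leNgt y1 orbT.
  apply/seteqP; split => x //= []; rewrite !in_itv/= andbT => yx /andP[_].
  by rewrite ltNge (le_trans y1 yx).
have [y0|y0] := leP y 0.
  rewrite (_ : _ `&` _ = `]0, 1[%classic); last first.
    apply/seteqP; split => x /=; rewrite !in_itv/= andbT; first by case.
    by move=> /andP[x0 x1]; rewrite x0 x1 (le_trans y0 (ltW x0)).
  rewrite Rintegral_itv_obnd_cbnd; last first.
    by apply: integrableS (ih 0 1) => //; exact: subset_itv_oo_cc.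
  rewrite Rintegral_itv_bndo_bndc; last first.
    by apply: integrableS (ih 0 1) => //; exact: subset_itv_co_cc.
  rewrite Rintegral_derive_test//.
  by rewrite !h0 ?subrr ?oppr0// ?ltxx// ?andbF// => /andP[]; rewrite ltNge y0.
rewrite (_ : _ `&` _ = `[y, 1[%classic); last first.
  apply/seteqP; split => x /=; rewrite !in_itv/= andbT; first by move=> [-> /andP[]].
  by move=> /andP[yx x1]; rewrite yx x1 (lt_le_trans y0 yx).
rewrite Rintegral_itv_bndo_bndc; last first.
  by apply: integrableS (ih y 1) => //; exact: subset_itv_co_cc.
by rewrite Rintegral_derive_test// ?ltW// h0 ?ltxx ?andbF// sub0r.
Qed.

Lemma integrable_primitive01 k : mu.-integrable setT (EFin \o k) ->
  mu.-integrable `]0, 1[ (EFin \o primitive k).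
Proof.
move=> ik.
have i1 : mu.-integrable setT (EFin \o \1_(`]0, 1[ : set R)).
  exact: integrable_indic_itv.
apply/integrable_mkcond => //.
apply: eq_integrable (integrable_mul_primitive i1 ik) => // x _.
rewrite /= indicE patchE; case: ifPn => x01; first by rewrite mul1r.
by rewrite mul0r.
Qed.

(** The test function is the integral of its own derivative, so moving the
    derivative is an exchange of the order of integration. *)
Lemma is_weak_derivative_primitive c u k : mu.-integrable setT (EFin \o k) ->
  (forall x, 0 < x < 1 -> u x = c + primitive k x) -> is_weak_derivative u k.
Proof.
move=> ik uE.
have iu : mu.-integrable `]0, 1[ (EFin \o u).
  have ic : mu.-integrable `]0, 1[ (cst c%:E).
    apply: (measurable_bounded_integrable (f := cst c)) => //.
    - by rewrite /= lebesgue_measure_itv/= lte_fin ltr01 -EFinB ltry.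
    - exists `|c|; split; first exact: num_real.
      by move=> M /ltW cM x _.
  apply: eq_integrable (integrableD _ ic (integrable_primitive01 ik)) => //.
  by move=> x; rewrite inE/= in_itv/= => /uE ->.
split.
- exact: open_integrable_locally (interval_open _ _) iu.
- apply: open_integrable_locally; first exact: interval_open.
  exact: (integrableS measurableT).
move=> h Th; have im := integrable_derive_test Th.
have h0 := test_function_eq0 (x := _) Th.
pose m := derive1 h \_ `]0, 1[.
(* the constant [c] does not contribute: the integral of [m] is [- h 0] *)
have m0 : \int[mu]_x m x = 0.
  rewrite -[RHS]oppr0 -(h0 0) ?ltxx// -Rintegral_derive_test_tail//.
  rewrite [RHS]Rintegral_mkcond; apply: eq_Rintegral => x _.
  rewrite /m !patchE; case: ifPn => [x01|_]; last by case: ifPn.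
  case: ifPn => //; rewrite notin_setE; case.
  by move: x01; rewrite inE/= !in_itv/= andbT => /andP[/ltW ->].
transitivity (\int[mu]_x (c * m x + m x * primitive k x)).
  rewrite Rintegral_mkcond; apply: eq_Rintegral => x _.
  rewrite /m !patchE; case: ifPn => x01; last by rewrite mulr0 mul0r addr0.
  by rewrite uE; [ring|move: x01; rewrite inE/= in_itv].
rewrite RintegralD//; last 2 first.
- exact: (integrableZl measurableT c im).
- exact: integrable_mul_primitive.
rewrite RintegralZl// m0 mulr0 add0r Rintegral_mul_primitive//.
transitivity (\int[mu]_x (-1 * (k x * h x))).
  by apply: eq_Rintegral => x _; rewrite Rintegral_derive_test_tail//; ring.
rewrite RintegralZl//; last first.
  apply: eq_integrable (integrable_mul_test measurableT ik Th) => //.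
rewrite mulN1r [in RHS]Rintegral_mkcond; congr (- _).
apply: eq_Rintegral => x _; rewrite patchE; case: ifPn => // x01.
by rewrite h0 ?mulr0// => x01'; move: x01; rewrite notin_setE/= in_itv.
Qed.

End weak_derivative_existence.

Section fundamental_lemma.
Context {R : realType}.
Local Notation mu := (@lebesgue_measure R).
Implicit Types (f g h k u w : R -> R) (a b c e x : R).

Definition continuously_derivable f : Prop :=
  (forall x, derivable f x 1) /\ continuous (derive1 f).

Lemma continuously_derivable_continuous f :
  continuously_derivable f -> continuous f.
Proof.
by move=> [df _] x; apply/differentiable_continuous/derivable1_diffP/df.
Qed.

Lemma continuously_derivable_cst c : continuously_derivable (fun=> c).
Proof.
split=> [x|]; first exact: derivable_cst.
rewrite (_ : derive1 _ = (fun=> 0)); first exact: cst_continuous.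
by apply/funext => x; rewrite derive1_cst.
Qed.

Lemma continuously_derivableB f g : continuously_derivable f ->
  continuously_derivable g -> continuously_derivable (fun x => f x - g x).
Proof.
move=> [df cf] [dg cg]; split=> [x|]; first exact: derivableB.
rewrite (_ : derive1 _ = (fun x => derive1 f x - derive1 g x)).
  by move=> x; apply: cvgB; [exact: cf|exact: cg].
by apply/funext => x; rewrite !derive1E -deriveB.
Qed.

Lemma continuously_derivableM f g : continuously_derivable f ->
  continuously_derivable g -> continuously_derivable (fun x => f x * g x).
Proof.
move=> [df cf] [dg cg]; split=> [x|]; first exact: derivableM.
rewrite (_ : derive1 _ = (fun x => f x * derive1 g x + g x * derive1 f x)).
  move=> x; apply: cvgD; apply: cvgM.
  - exact: (continuously_derivable_continuous (conj df cf)).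
  - exact: cg.
  - exact: (continuously_derivable_continuous (conj dg cg)).
  - exact: cf.
by apply/funext => x; rewrite !derive1E deriveM.
Qed.

Lemma continuously_derivableX f n : continuously_derivable f ->
  continuously_derivable (fun x => f x ^+ n).
Proof.
move=> Cf; elim: n => [|n IH].
  by under eq_fun do rewrite expr0; exact: continuously_derivable_cst.
by under eq_fun do rewrite exprS; exact: continuously_derivableM.
Qed.

(** A remainder bound uniform in both points, so that no case distinction at the
    kink of the positive part is needed to differentiate its square. *)
Lemma sqr_pos_part_taylor (x y : R) :
  `|Num.max 0 y ^+ 2 - Num.max 0 x ^+ 2 - 2 * Num.max 0 x * (y - x)| <=
  (y - x) ^+ 2.
Proof.
rewrite ler_norml; have := sqr_ge0 (y - x); rewrite !expr2.
case: (leP 0 y) => y0; case: (leP 0 x) => x0 => d0.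
- by apply/andP; split; lra.
- have xy : x * y <= 0 by exact: mulr_le0_ge0 (ltW x0) y0.
  have xx : 0 <= x * x by rewrite -expr2 sqr_ge0.
  have yy : 0 <= y * y by rewrite -expr2 sqr_ge0.
  by apply/andP; split; lra.
- have xy : x * y <= 0 by exact: mulr_ge0_le0 x0 (ltW y0).
  have xx : 0 <= x * x by rewrite -expr2 sqr_ge0.
  have yy : 0 <= y * y by rewrite -expr2 sqr_ge0.
  by apply/andP; split; lra.
- by apply/andP; split; lra.
Qed.

Lemma continuously_derivable_sqr_pos_part e c : e ^+ 2 = 1 ->
  continuously_derivable (fun x => Num.max 0 (e * x + c) ^+ 2).
Proof.
move=> e1; set f := fun x => _.
pose f' x := 2 * Num.max 0 (e * x + c) * e.
have Hf x : h^-1 *: (f (h + x) - f x) @[h --> 0^'] --> f' x.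
  apply/cvgrPdist_le => eps eps0; near=> h.
  have h0 : h != 0 by near: h; exact: nbhs_dnbhs_neq.
  rewrite (_ : _ - _ = - h^-1 * (f (h + x) - f x - f' x * h)); last first.
    by rewrite /GRing.scale/=; field.
  rewrite normrM normrN normfV ler_pdivrMl ?normr_gt0//.
  apply: (@le_trans _ _ (`|h| * `|h|)); last first.
    rewrite ler_wpM2l//; near: h; exact: dnbhs0_le.
  have := sqr_pos_part_taylor (e * x + c) (e * (h + x) + c).
  rewrite (_ : (_ - _) ^+ 2 = `|h| * `|h|); last first.
    by rewrite -normrM ger0_norm ?sqr_ge0 -?expr2 ?sqr_ge0//;
      transitivity (e ^+ 2 * h ^+ 2); [ring|rewrite e1 mul1r].
  by congr (`|_| <= _); rewrite /f /f'; ring.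
have derf x : derivable f x 1.
  apply/cvg_ex; exists (f' x).
  have := Hf x; set d := (fun _ : R => _) ; set d' := (fun _ : R => _).
  suff -> : d = d' by [].
  by rewrite funeqE => h; rewrite /d /d' /= [h%:A]mulr1.
split; first exact: derf.
rewrite (_ : derive1 f = f').
  move=> x; apply: cvgM; last exact: cvg_cst.
  apply: cvgM; first exact: cvg_cst.
  have maxE y : Num.max 0 (e * y + c) = 2^-1 * (`|e * y + c| + (e * y + c)).
    case: (leP 0 (e * y + c)) => y0.
      by rewrite ger0_norm//; field.
    by rewrite ltr0_norm// addNr mulr0.
  have cl : (e * y + c) @[y --> x] --> e * x + c.
    apply: cvgD; last exact: cvg_cst.
    by apply: cvgM; [exact: cvg_cst|exact: cvg_id].
  under eq_fun do rewrite maxE.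
  rewrite maxE; apply: cvgM; first exact: cvg_cst.
  by apply: cvgD => //; exact: cvg_norm.
by apply/funext => x; apply/cvg_lim => //; exact: Hf.
Unshelve. all: by end_near. Qed.

(** The bumps are [1 - (1 - q) ^+ n] with [q] the squared product of the positive
    parts of [x - a] and [b - x]: they increase to the indicator of the interval
    while keeping their support in its closure. *)
Lemma test_function_approx_itv a b : 0 < a -> a < b -> b < 1 ->
  exists q : R -> R,
    [/\ forall n, test_function (fun x => 1 - (1 - q x) ^+ n),
        forall x, a < x < b -> 0 < q x <= 1 &
        forall x, ~ (a < x < b) -> q x = 0].
Proof.
move=> a0 ab b1.
pose q x : R := Num.max 0 (1 * x + - a) ^+ 2 * Num.max 0 (-1 * x + b) ^+ 2.
have q0 x : ~ (a < x < b) -> q x = 0.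
  move=> /negP; rewrite negb_and -!leNgt /q => /orP[xa|bx].
    by rewrite max_l ?expr0n ?mul0r// mul1r subr_le0.
  by rewrite [X in _ * X ^+ 2]max_l ?expr0n ?mulr0// mulN1r addrC subr_le0.
exists q; split => //; last first.
  move=> x /andP[ax xb]; rewrite /q !max_r; [|lra|lra].
  rewrite -exprMn exprn_gt0/=; last by rewrite mulr_gt0//; lra.
  by rewrite expr_le1//; [nra|rewrite mulr_ge0//; lra].
have Cq : continuously_derivable q.
  apply: continuously_derivableM; apply: continuously_derivable_sqr_pos_part.
    by rewrite expr1n.
  by rewrite sqrrN expr1n.
move=> n.
have [dh ch] : continuously_derivable (fun x => 1 - (1 - q x) ^+ n).
  apply: continuously_derivableB; first exact: continuously_derivable_cst.
  apply: continuously_derivableX.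
  by apply: continuously_derivableB => //; exact: continuously_derivable_cst.
split=> //; apply: (@subset_trans _ `[a, b]%classic).
  rewrite [X in _ `<=` X](closure_id _).1; last exact: interval_closed.
  apply: closure_subset => x /= h0; rewrite in_itv/=; apply: contrapT => nab.
  move: h0; rewrite q0 ?subr0 ?expr1n ?subrr ?eqxx// => /andP[/ltW ax /ltW xb].
  by apply: nab; rewrite ax xb.
by move=> x /=; rewrite !in_itv/= => /andP[ax xb]; apply/andP; split; lra.
Qed.

Lemma locally_integrable_itv k a b : 0 < a -> b < 1 ->
  locally_integrable `]0, 1[ k -> mu.-integrable `[a, b] (EFin \o k).
Proof.
move=> a0 b1 [mk _ ik].
have sub : `[a, b]%classic `<=` (`]0, 1[%classic : set R).
  by move=> x /=; rewrite !in_itv/= => /andP[ax xb]; apply/andP; split; lra.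
apply/integrableP; split.
  by apply/measurable_EFinP; exact: measurable_funS sub mk.
by apply: ik => //; exact: segment_compact.
Qed.

(** Dominated convergence along the bumps, whose limit is the indicator of the
    interval. *)
Lemma Rintegral_itv_eq0 k a b : locally_integrable `]0, 1[ k ->
  (forall h, test_function h -> \int[mu]_(x in `]0, 1[) (k x * h x) = 0) ->
  0 < a -> a < b -> b < 1 -> \int[mu]_(x in `]a, b[) k x = 0.
Proof.
move=> lk kh0 a0 ab b1.
have ik := locally_integrable_itv a0 b1 lk.
have [q [Tq q01 q0]] := test_function_approx_itv a0 ab b1.
have abI : `]a, b[%classic `<=` (`[a, b]%classic : set R).
  exact: subset_itv_oo_cc.
pose h n x : R := 1 - (1 - q x) ^+ n.
have h0 n x : ~ (a < x < b) -> h n x = 0.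
  by move=> /q0; rewrite /h => ->; rewrite subr0 expr1n subrr.
have h1 n x : `|h n x| <= 1.
  have [xab|/negP xab] := boolP (a < x < b); last by rewrite h0 ?normr0.
  have /andP[qx0 qx1] := q01 _ xab.
  have qn0 : 0 <= (1 - q x) ^+ n by rewrite exprn_ge0 ?subr_ge0.
  have qn1 : (1 - q x) ^+ n <= 1 by rewrite exprn_ile1//; lra.
  by rewrite /h ger0_norm; lra.
have [] := @dominated_convergence _ (measurableTypeR R) R mu _ (measurable_itv `]a, b[)
  (fun n x => (k x * h n x)%:E) (EFin \o k) (fun x => `|(k x)%:E|%E).
- move=> n; apply: (measurable_int mu).
  apply: integrable_mul_test => //; last exact: Tq.
  exact: integrableS ik.
- apply: (measurable_int mu); exact: integrableS ik.
- apply: aeW => x; rewrite /= in_itv/= => xab.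
  rewrite -[X in _ --> X%:E]mulr1; apply: cvg_EFin; first exact: nearW.
  apply: cvgMl_tmp; rewrite -[X in _ --> X]subr0.
  apply: cvgB; first exact: cvg_cst.
  apply: cvg_expr; have /andP[qx0 qx1] := q01 _ xab.
  by rewrite ger0_norm; lra.
- apply: integrable_abse; exact: integrableS ik.
- apply: aeW => x n _; rewrite /= lee_fin normrM ler_piMr//.
move=> _ _ /=.
have E0 n : (\int[mu]_(x in `]a, b[) (k x * h n x)%:E = 0)%E.
  have i : mu.-integrable `]a, b[ (fun x => (k x * h n x)%:E).
    by apply: integrable_mul_test => //; [exact: integrableS ik|exact: Tq].
  rewrite -[LHS]fineK; last exact: integrable_fin_num.
  congr EFin; rewrite -[RHS](kh0 _ (Tq n)) -/(Rintegral _ _ _).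
  rewrite Rintegral_mkcond [RHS]Rintegral_mkcond.
  apply: eq_Rintegral => x _; rewrite !patchE !mem_setE !in_itv/=.
  have [/andP[ax xb]|/negP xab] := boolP (a < x < b).
    by rewrite (lt_trans a0 ax) (lt_trans xb b1).
  by case: ifPn => // _; rewrite -/(h n x) h0 ?mulr0.
under eq_fun do rewrite E0.
move=> /(@cvg_unique _ (@ereal_hausdorff R) _ _ _ _ (@cvg_cst _ _ _ _ _)) H.
by rewrite /Rintegral -H.
Qed.

(** The integrals over all compactly contained intervals vanish, so the primitives
    based at an interior point are constant. A locally integrable [k] may fail to
    be integrable near the endpoints, hence the exhaustion by the intervals
    [[1/(n+2), 1 - 1/(n+2)]]. *)
Lemma du_bois_reymond k : locally_integrable `]0, 1[ k ->
  (forall h, test_function h -> \int[mu]_(x in `]0, 1[) (k x * h x) = 0) ->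
  {ae mu, forall x, 0 < x < 1 -> k x = 0}.
Proof.
move=> lk kh0.
have k0 n : {ae mu, forall x, n.+2%:R^-1 < x < 1 - n.+2%:R^-1 -> k x = 0}.
  set a : R := n.+2%:R^-1.
  have a0 : 0 < a by rewrite invr_gt0 ltr0n.
  have a1 : a < 1 by rewrite invf_lt1 ?ltr0n// ltr1n.
  have ik : mu.-integrable `[a, 1 - a] (EFin \o k).
    by apply: locally_integrable_itv => //; lra.
  pose K := k \_ `[a, 1 - a].
  have iK : mu.-integrable setT (EFin \o K).
    by move/integrable_mkcond : ik; rewrite -restrict_EFin; apply.
  have : {ae mu, forall x, a < x < 1 - a -> primitive K x = 0}.
    apply: aeW => x /andP[ax xa]; rewrite /primitive -Rintegral_mkcondr.
    rewrite (_ : _ `&` _ = `[a, x]%classic); last first.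
      apply/seteqP; split => y /=; rewrite !in_itv/=.
        by move=> [-> /andP[->]].
      by move=> /andP[ay yx]; rewrite yx ay (le_trans yx (ltW xa)).
    have iax (u v : bool) : mu.-integrable
        [set` Interval (BSide u a) (BSide v x)] (EFin \o k).
      apply: integrableS ik => // y /=; rewrite !itv_boundlr/=.
      move=> /andP[ay yx]; apply/andP; split.
        by apply: le_trans ay; case: (u); rewrite bnd_simp.
      by apply: le_trans yx _; case: (v); rewrite bnd_simp ltW.
    rewrite -Rintegral_itv_obnd_cbnd; last exact: iax.
    rewrite -Rintegral_itv_bndo_bndc; last exact: iax.
    by apply: Rintegral_itv_eq0 => //; lra.
  move=> /(ae_eq0_primitive iK); apply: filterS => x /= Kx xa.
  rewrite -(Kx xa) /K patchE mem_set//= in_itv/=.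
  by move: xa => /andP[/ltW -> /ltW ->].
apply: filterS (ae_foralln k0) => x /= kx /andP[x0 x1].
have [n] : exists n : nat, n.+2%:R^-1 < Num.min x (1 - x).
  have y0 : 0 < Num.min x (1 - x) by rewrite lt_min x0 subr_gt0.
  exists (Num.truncn (Num.min x (1 - x))^-1).
  rewrite invf_plt ?posrE ?ltr0n//.
  by rewrite (lt_trans (truncnS_gt _))// ltr_nat.
by rewrite lt_min => /andP[nx n1x]; apply: (kx n); rewrite nx/= ltrBrDr addrC -ltrBrDr.
Qed.

Lemma integrable_locally_mul_test k h : locally_integrable `]0, 1[ k ->
  test_function h -> mu.-integrable setT (fun x => (k x * h x)%:E).
Proof.
move=> [mk _ ik] Th; have [_ _ sh] := Th.
set S := closure [set x | h x != 0] in sh.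
have cS : compact S.
  apply: (subclosed_compact _ (@segment_compact _ 0 1)).
    exact: closed_closure.
  by apply: subset_trans sh _; exact: subset_itv_oo_cc.
have mS : measurable (S : set (measurableTypeR R)) by exact: compact_measurable.
have iS : mu.-integrable S (EFin \o k).
  apply/integrableP; split; last exact: ik.
  by apply/measurable_EFinP; exact: measurable_funS sh mk.
have := integrable_mul_test mS iS Th.
move/integrable_mkcond => /(_ mS); apply: eq_integrable => // x _.
rewrite patchE; case: ifPn => //; rewrite notin_setE => Sx.
suff -> : h x = 0 by rewrite mulr0.
by apply: contrapT => /eqP hx; apply: Sx; exact: subset_closure.
Qed.

(** Whichever representative of the weak derivative enters the energy, it can be
    replaced under the integral by an explicit one. *)
Lemma is_weak_derivative_unique u v w :
  is_weak_derivative u v -> is_weak_derivative u w ->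
  {ae mu, forall x, 0 < x < 1 -> v x = w x}.
Proof.
move=> [_ lv uv] [_ lw uw].
have lvw : locally_integrable `]0, 1[ (v \- w) by exact: locally_integrableB.
have : {ae mu, forall x, 0 < x < 1 -> (v \- w) x = 0}.
  apply: du_bois_reymond => // h Th.
  have iv := integrable_locally_mul_test lv Th.
  have iw := integrable_locally_mul_test lw Th.
  transitivity (\int[mu]_(x in `]0, 1[) (v x * h x - w x * h x)).
    by apply: eq_Rintegral => x _; rewrite /= mulrBl.
  rewrite RintegralB//; [|exact: integrableS iv|exact: integrableS iw].
  by apply/eqP; rewrite subr_eq0 -eqr_opp -uv// -uw.
by apply: filterS => x H x01; apply/eqP; rewrite -subr_eq0; apply/eqP/H.
Qed.

End fundamental_lemma.

(** * Membership in Lp on an interval *)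

Section Lp.
Context {R : realType}.
Local Notation mu := (@lebesgue_measure R).
Implicit Types (p : R) (D : set (measurableTypeR R)) (f : R -> R).

Let normr_powR_restrict p D f x : 0 < p ->
  ((`|(f \_ D) x| `^ p)%:E = ((fun x => (`|f x| `^ p)%:E) \_ D) x)%E.
Proof.
move=> p0; rewrite !patchE; case: ifPn => // _.
by rewrite normr0 powR0// gt_eqF.
Qed.

Lemma in_LpP p D f : 1 <= p -> measurable D ->
  in_Lp p D f <->
  measurable_fun D f /\ mu.-integrable D (fun x => (`|f x| `^ p)%:E).
Proof.
move=> p1 mD; have p0 : 0 < p by exact: lt_le_trans p1.
split.
- move=> fL; split.
    apply/(@measurable_restrictT _ _ (measurableTypeR R) R D f mD).
    by move: fL; rewrite /in_Lp inE => /andP[/[!inE]/=].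
  apply/(integrable_mkcond _ mD).
  apply: eq_integrable (Lfun_integrable p1 fL) => // x _.
  exact: normr_powR_restrict.
- move=> [mf /(integrable_mkcond _ mD) /integrableP[_ ifoo]].
  rewrite /in_Lp inE; apply/andP; split; rewrite inE/=.
    exact/(@measurable_restrictT _ _ (measurableTypeR R) R D f mD).
  rewrite /finite_norm unlock; apply: poweR_lty; apply: le_lt_trans ifoo.
  rewrite le_eqVlt; apply/orP; left; apply/eqP; apply: eq_integral => x _ /=.
  by rewrite -normr_powR_restrict// gee0_abs ?lee_fin ?powR_ge0.
Qed.

(** On a bounded interval [1 + |f| ^ p] is an integrable majorant of [|f|]. *)
Lemma in_Lp_integrable p (a b : R) f : 1 <= p ->
  in_Lp p `]a, b[ f -> mu.-integrable `]a, b[ (EFin \o f).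
Proof.
move=> p1 /in_LpP[]// mf ipf.
have i1 : mu.-integrable `]a, b[ (EFin \o cst 1).
  apply: measurable_bounded_integrable => //.
  - rewrite /= lebesgue_measure_itv/=; case: ifP => _; last exact: ltry.
    by rewrite -EFinB ltry.
  - exists 1; split; first exact: num_real.
    by move=> M /ltW cM x _; rewrite /= normr1.
apply: (le_integrable _ _ _ (integrableD _ i1 ipf)) => //.
  exact/measurable_EFinP.
move=> x _ /=; rewrite lee_fin [leRHS]ger0_norm ?addr_ge0 ?powR_ge0//.
have [x1|x1] := leP `|f x| 1; first by rewrite (le_trans x1)// lerDl powR_ge0.
by rewrite (le_trans (le1r_powR (ltW x1) p1))// lerDr.
Qed.

End Lp.

(** * A profile with slowly decaying truncations *)

Section profile.
Context {R : realType}.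
Local Notation mu := (@lebesgue_measure R).
Implicit Types (p : R) (c d : nat -> R).

(** [G] is the [p]-th root of the sum of the functions [c k ^ p] cut off to
    [(0, d k)]. The intervals overlap, but adding [p]-th powers controls the [Lp]
    norm of [G] term by term and keeps [G] above each [c k] where it should be.
    The sum may be infinite, though only on a null set. *)
Lemma exists_singular_profile p c d : 1 <= p ->
  (forall k, 0 <= c k) -> (forall k, 0 < d k) ->
  (\sum_(k <oo) (c k `^ p * d k)%:E < +oo)%E ->
  exists G : R -> R, [/\ forall x, 0 <= G x, in_Lp p `]0, 1[ G &
    {ae mu, forall x, forall k, 0 < x < d k -> c k <= G x}].
Proof.
move=> p1 c0 d0 sumcd.
have p0 : 0 < p by exact: lt_le_trans p1.
pose Hk k (x : R) : \bar R := (c k `^ p * \1_(`]0, d k[ : set R) x)%:E.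
have Hk0 k x : (0 <= Hk k x)%E by rewrite lee_fin mulr_ge0 ?powR_ge0.
have mHk k : measurable_fun [set: measurableTypeR R] (Hk k).
  by apply/measurable_EFinP; apply: measurable_funM => //; exact: measurable_indic.
pose H x := (\sum_(k <oo) Hk k x)%E.
have mH : measurable_fun [set: measurableTypeR R] H.
  by apply: ge0_emeasurable_sum => // k x _ _; exact: Hk0.
have H0 x : (0 <= H x)%E by exact: nneseries_ge0.
have iH : mu.-integrable setT H.
  apply/integrableP; split => //.
  under eq_integral do rewrite gee0_abs//.
  rewrite integral_nneseries//; apply: le_lt_trans sumcd.
  apply: lee_nneseries => [k _ _|k _]; first exact: integral_ge0.
  rewrite /Hk; under eq_integral do rewrite EFinM.
  rewrite ge0_integralZl//; last 2 first.
  - by apply/measurable_EFinP; exact: measurable_indic.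
  - by rewrite lee_fin powR_ge0.
  rewrite integral_indic// setIT /= lebesgue_measure_itv/= lte_fin d0.
  by rewrite -EFinB subr0 -EFinM.
pose G x := fine (H x) `^ p^-1.
have G0 x : 0 <= G x by exact: powR_ge0.
have GpE x : G x `^ p = fine (H x).
  by rewrite /G -powRrM mulVf ?gt_eqF// powRr1// fine_ge0.
have iG : mu.-integrable setT (EFin \o (fine \o H)).
  apply: le_integrable iH => //.
    apply/measurable_EFinP; apply: measurableT_comp mH; exact: fine_measurable.
  move=> x _ /=; rewrite (gee0_abs (H0 x)) ger0_norm ?fine_ge0//.
  by case: (H x) (H0 x) => //= _; rewrite leey.
exists G; split => //.
- apply/in_LpP => //; split.
    apply: measurable_funTS; apply: (measurableT_comp (measurable_powR _)).
    by apply: measurableT_comp mH; exact: fine_measurable.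
  apply: (integrableS measurableT) => //.
  apply: eq_integrable iG => // x _.
  by rewrite /= ger0_norm// GpE.
- apply: filterS (integrable_ae measurableT iH) => x /= /(_ I) Hfin k xk.
  have p_neq0 : p != 0 by rewrite gt_eqF.
  rewrite -[leLHS]powRr1// -(mulfV p_neq0) powRrM.
  apply: ge0_ler_powR; [by rewrite invr_ge0 ltW|
    by rewrite nnegrE powR_ge0|by rewrite nnegrE fine_ge0|].
  suff : ((c k `^ p)%:E <= (fine (H x))%:E)%E by rewrite lee_fin.
  rewrite fineK//.
  have -> : ((c k `^ p)%:E = Hk k x)%E.
    by rewrite /Hk indicE mem_set ?mulr1//= in_itv.
  apply: le_trans (nneseries_lim_ge k.+1 _); last by move=> *; exact: Hk0.
  by rewrite big_nat_recr//= leeDr// sume_ge0.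
Qed.

(** After [n] reflections at the boundary a solution may have lost [n * C] in
    modulus, and [C * (t + 1)] bounds this loss at time [t]. The profile keeps, above
    that level, at least the mass [phi t ^ p]. *)
Lemma slow_profile p (C : R) (phi : R -> R) : 1 <= p -> 0 < C ->
  (forall t, 0 <= t -> 0 < phi t) ->
  (forall s t, 0 <= s -> s <= t -> phi t <= phi s) ->
  phi t @[t --> +oo] --> (0 : R) ->
  exists G : R -> R, [/\ forall x, 0 <= G x, in_Lp p `]0, 1[ G &
    forall t, 0 <= t -> exists c d : R,
      [/\ 0 < d <= 2^-1, {ae mu, forall x, 0 < x < d -> c <= G x},
          C * (t + 1) <= c & phi t `^ p <= (c - C * (t + 1)) `^ p * d]].
Proof.
move=> p1 C0 phi0 dphi phi_lim.
have p0 : 0 < p by exact: lt_le_trans p1.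
(* [eps 0 = M / 2] dominates [phi ^ p], and the [eps k] are summable *)
pose M := 1 + 2 * phi 0 `^ p.
have M1 : 1 <= M by rewrite lerDl mulr_ge0 ?powR_ge0.
have M0 : 0 < M by exact: lt_le_trans M1.
pose eps k : R := M / (2 ^ k.+1)%:R.
have eps0 k : 0 < eps k by rewrite divr_gt0// ltr0n expn_gt0.
have [T HT] : {T : nat -> R & forall k, k%:R <= T k /\
    forall t, T k <= t -> phi t `^ p <= eps k}.
  apply: (@choice _ _ (fun k T => k%:R <= T /\
    forall t, T <= t -> phi t `^ p <= eps k)) => k.
  have e0 : 0 < eps k `^ p^-1 by exact: powR_gt0.
  have /cvgrPdist_lt/(_ _ e0)[A [_ HA]] := phi_lim.
  exists (Num.max k%:R (A + 1)); split; first by rewrite le_max lexx.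
  move=> t; rewrite ge_max => /andP[kt At].
  have t0 : 0 <= t by exact: le_trans kt.
  have pt : phi t <= eps k `^ p^-1.
    have := HA t; rewrite sub0r normrN gtr0_norm ?phi0// => H.
    by apply/ltW/H; rewrite (lt_le_trans _ At)// ltrDl.
  have -> : eps k = (eps k `^ p^-1) `^ p.
    by rewrite -powRrM mulVf ?gt_eqF// powRr1// ltW.
  by apply: ge0_ler_powR => //; rewrite ?nnegrE ?powR_ge0 ?ltW// phi0.
(* On the time interval between [T k] and [T k.+1] the loss is at most [b k]; a
   height [2 * b k] then keeps [b k], at the cost of a factor [2 ^ p] in the norm.
   The term [2 * M] makes the widths [d k] at most [1 / 2]. *)
pose b k := C * (T k.+1 + 1) + 2 * M.
have T0 k : 0 <= T k by exact: le_trans (HT k).1.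
have b2 k : 2 * M <= b k.
  by rewrite lerDr mulr_ge0 ?ltW// ltr_wpDl.
have b0 k : 0 < b k by apply: lt_le_trans (b2 k); rewrite mulr_gt0.
pose d k := eps k / b k `^ p.
have d0 k : 0 < d k by rewrite divr_gt0// powR_gt0.
have dE k : b k `^ p * d k = eps k.
  by rewrite mulrC divfK// gt_eqF// powR_gt0.
have d2 k : d k <= 2^-1.
  rewrite ler_pdivrMr ?powR_gt0//.
  have bp : b k <= b k `^ p by apply: le1r_powR => //; have := b2 k; lra.
  have eM : eps k <= M.
    rewrite ler_pdivrMr ?ltr0n ?expn_gt0//; apply: ler_peMr; first exact: ltW.
    by rewrite ler1n expn_gt0.
  have := b2 k; lra.
pose c k := 2 * b k.
have [] := @exists_singular_profile p c d p1.
- by move=> k; rewrite mulr_ge0 ?ltW.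
- exact: d0.
- apply: (@le_lt_trans _ _ (2 `^ p * M)%:E); last exact: ltry.
  apply: le_trans (epsilon_trick0 xpredT _); last first.
    by rewrite mulr_ge0 ?powR_ge0 ?ltW.
  apply: lee_nneseries => [k _ _|k _].
    by rewrite lee_fin mulr_ge0 ?powR_ge0// ltW.
  by rewrite lee_fin /c powRM ?(ltW (b0 k))// -mulrA dE /eps mulrA.
move=> G [G0 LG cG]; exists G; split=> // t t0.
(* the first [k] with [t < T k.+1] also satisfies [T k <= t], unless it is [0] *)
have [k kt phik] : exists2 k, t < T k.+1 & phi t `^ p <= eps k.
  have exT : exists k, t < T k.+1.
    exists (Num.truncn t); apply: lt_le_trans (HT _).1; exact: truncnS_gt.
  have [[|j] tT minj] := ex_minnP exT.
    exists 0 => //; apply: (@le_trans _ _ (phi 0 `^ p)).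
      apply: ge0_ler_powR; rewrite ?nnegrE ?(ltW p0) ?(ltW (phi0 _ _))//.
      exact: dphi.
    by rewrite /eps expn1 /M ler_pdivlMr//; lra.
  exists j.+1 => //; apply: (HT _).2; rewrite leNgt; apply/negP => /minj.
  by rewrite ltnn.
have tb : C * (t + 1) <= b k.
  have : C * (t + 1) <= C * (T k.+1 + 1) by rewrite ler_pM2l// lerD2r ltW.
  by rewrite /b; lra.
have bk := b0 k.
exists (c k), (d k); split.
- by rewrite d0 d2.
- by apply: filterS cG => x /=; apply.
- by rewrite /c; lra.
- apply: (@le_trans _ _ (eps k)) => //; rewrite -(dE k) ler_pM2r//.
  by apply: ge0_ler_powR; rewrite ?nnegrE ?(ltW p0)// /c; lra.
Qed.

End profile.

(** * Travelling waves of a solution *)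

Section waves.
Context {R : realType}.
Local Notation mu := (@lebesgue_measure R).
Implicit Types (p t x T : R) (Sigma : set (R * R)) (f g : R -> R)
  (z : R -> R -> R).

Let s2 : R := (Num.sqrt 2)^-1.

(** Cutting the travelling waves off at time [T] makes them integrable on the
    whole line without changing the solution before that time. *)
Let fT f T := f \_ `]0, T[.
Let gT g T := g \_ `](-1), T[.

Let fTE f T x : 0 < x < T -> fT f T x = f x.
Proof. by move=> xT; rewrite /fT patchE mem_set//= in_itv. Qed.

Let gTE g T x : -1 < x < T -> gT g T x = g x.
Proof. by move=> xT; rewrite /gT patchE mem_set//= in_itv. Qed.

Let integrable_fT p f T : 1 <= p -> 0 < T -> in_Lp_loc p 0 f ->
  mu.-integrable setT (EFin \o fT f T).
Proof.
by move=> p1 T0 /(_ _ T0)/(in_Lp_integrable p1)/integrable_restrict_itv.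
Qed.

Let integrable_gT p g T : 1 <= p -> -1 < T -> in_Lp_loc p (-1) g ->
  mu.-integrable setT (EFin \o gT g T).
Proof.
by move=> p1 T0 /(_ _ T0)/(in_Lp_integrable p1)/integrable_restrict_itv.
Qed.

Let wave_primitiveE p Sigma (z0 z1 : R -> R) z f g T t x : 1 <= p ->
  wave_solution p Sigma z0 z1 z f g -> 0 <= t -> 0 <= x <= 1 -> t + x < T ->
  z t x = s2 * (primitive (fT f T) (t + x) - primitive (fT f T) 0) +
          s2 * (primitive (gT g T) (t - x) - primitive (gT g T) 0).
Proof.
move=> p1 [Lf Lg zE _ _] t0 x01 txT; have /andP[x0 x1] := x01.
rewrite zE//; congr (s2 * _ + s2 * _).
- apply: int_from_toE; first by apply: integrable_fT Lf => //; lra.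
  move=> y; rewrite gt_min lt_max => y0tx; rewrite fTE//.
  by case/andP: y0tx => /orP[] ? /orP[] ?; apply/andP; split; lra.
- apply: int_from_toE; first by apply: integrable_gT Lg => //; lra.
  move=> y; rewrite gt_min lt_max => y0tx; rewrite gTE//.
  by case/andP: y0tx => /orP[] ? /orP[] ?; apply/andP; split; lra.
Qed.

(** The condition [z t 0 = 0] makes the primitive of [f + g] constant. *)
Lemma wave_boundary p Sigma (z0 z1 : R -> R) z f g : 1 <= p ->
  wave_solution p Sigma z0 z1 z f g ->
  {ae mu, forall x, 0 < x -> f x = - g x}.
Proof.
move=> p1 Hz; have [Lf Lg _ bnd _] := Hz.
suff H n : {ae mu, forall x, 0 < x < n.+1%:R -> f x = - g x}.
  apply: filterS (ae_foralln H) => x /= fg x0; apply: (fg (Num.truncn x)).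
  by rewrite x0 truncnS_gt.
set T : R := n.+1%:R; have T0 : 0 < T by rewrite ltr0n.
have iF := integrable_fT p1 T0 Lf.
have iG : mu.-integrable setT (EFin \o gT g T).
  by apply: integrable_gT Lg => //; lra.
have iFG : mu.-integrable setT (EFin \o (fun y => fT f T y + gT g T y)).
  exact: (integrableD measurableT iF iG).
have := @ae_eq0_primitive R _ 0 T (primitive (fT f T) 0 + primitive (gT g T) 0) iFG.
move=> H; have {}H := H _; apply: filterS (H _) => [x /= fg0 x0T|].
  have := fg0 x0T; rewrite fTE// gTE; last first.
    by case/andP: x0T => ? ?; apply/andP; split; lra.
  by move/eqP; rewrite addr_eq0 => /eqP.
apply: filterS bnd => t /= tz /andP[t0 tT].
have [z0t _] := tz (ltW t0).
move: z0t; rewrite (wave_primitiveE (T := T) p1 Hz) ?lexx ?ler01 ?addr0 ?subr0//;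
  last exact: ltW.
rewrite primitiveD// -mulrDr => /eqP; rewrite mulf_eq0 invr_eq0 sqrtr_eq0.
by rewrite lt_geF//= => /eqP ?; lra.
Qed.

(** At a fixed time the solution is a primitive of [z_x], with an integrable
    extension of [z_x] to the line. *)
Lemma wave_space_primitive p Sigma (z0 z1 : R -> R) z f g t : 1 <= p ->
  wave_solution p Sigma z0 z1 z f g -> 0 <= t ->
  exists (k : R -> R) (c : R), [/\ mu.-integrable setT (EFin \o k),
    forall x, 0 < x < 1 -> k x = wave_x f g t x &
    forall x, 0 <= x <= 1 -> z t x = c + primitive k x].
Proof.
move=> p1 Hz t0; have [Lf Lg _ _ _] := Hz.
pose T : R := t + 2; have T0 : 0 < T by rewrite /T; lra.
have iF := integrable_fT p1 T0 Lf.
have iG : mu.-integrable setT (EFin \o gT g T).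
  by apply: integrable_gT Lg => //; lra.
pose F x := fT f T (t + x); pose G x := gT g T (t - x).
have iFt : mu.-integrable setT (EFin \o F).
  exact: integrable_comp (measure_preserving_shift t) iF.
have iGt : mu.-integrable setT (EFin \o G).
  exact: integrable_comp (measure_preserving_reflection t) iG.
have iFG : mu.-integrable setT (EFin \o (fun x => F x - G x)).
  exact: (integrableB measurableT iFt iGt).
exists (fun x => s2 * (F x - G x)).
exists (s2 * (\int[mu]_y gT g T y - primitive (fT f T) 0
  - primitive (gT g T) 0)); split.
- exact: (integrableZl measurableT s2 iFG).
- move=> x /andP[x0 x1].
  have tx : 0 < t + x < T by apply/andP; split; rewrite /T; lra.
  have tx' : -1 < t - x < T by apply/andP; split; rewrite /T; lra.
  by rewrite /F /G (fTE _ tx) (gTE _ tx') /wave_x mulrC.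
- move=> x x01; have /andP[x0 x1] := x01.
  rewrite (wave_primitiveE (T := T) p1 Hz)//; last by rewrite /T; lra.
  rewrite primitiveZ// primitiveB// primitive_shift// primitive_reflection//.
  by ring.
Qed.

(** With zero initial position, [z_x] vanishes at time [0]. *)
Lemma wave_initial_symmetric p Sigma (z1 : R -> R) z f g : 1 <= p ->
  wave_solution p Sigma (fun=> 0) z1 z f g ->
  {ae mu, forall x, 0 < x < 1 -> f x = g (- x)}.
Proof.
move=> p1 Hz; have [_ _ _ _ ini] := Hz.
have [k [c [ik kE zE]]] := wave_space_primitive p1 Hz (lexx 0).
have P0 : {ae mu, forall x, 0 < x < 1 -> primitive k x = - c}.
  apply: filterS ini => x /= zx /andP[x0 x1].
  have x01 : 0 <= x <= 1 by rewrite !ltW.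
  by have [] := zx x01; rewrite zE// => /eqP; rewrite addrC addr_eq0 => /eqP.
apply: filterS (ae_eq0_primitive ik P0) => x /= k0 x01.
move: (k0 x01); rewrite kE// /wave_x add0r sub0r => /eqP.
by rewrite mulf_eq0 invr_eq0 sqrtr_eq0 lt_geF//= orbF subr_eq0 => /eqP.
Qed.

Lemma wave_is_weak_derivative p Sigma (z0 z1 : R -> R) z f g t : 1 <= p ->
  wave_solution p Sigma z0 z1 z f g -> 0 <= t ->
  {ae mu, forall x, 0 < x < 1 -> weak_derivative (z t) x = wave_x f g t x} /\
  measurable_fun (`]0, 1[ : set (measurableTypeR R)) (weak_derivative (z t)).
Proof.
move=> p1 Hz t0; have [k [c [ik kE zE]]] := wave_space_primitive p1 Hz t0.
have wk : is_weak_derivative (z t) k.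
  apply: (is_weak_derivative_primitive (c := c)) => // x /andP[x0 x1].
  by rewrite zE// !ltW.
have ww : is_weak_derivative (z t) (weak_derivative (z t)).
  by apply: (@xgetPex _ (cst 0) [set w | is_weak_derivative (z t) w]); exists k.
split; last by have [_ []] := ww.
apply: filterS (is_weak_derivative_unique ww wk) => x /= wx x01.
by rewrite wx// kE.
Qed.

Let integrable_comp_itv (T : R -> R) (k : R -> R) (i j : interval R) :
  measure_preserving T -> [set` i] `<=` T @^-1` [set` j] ->
  mu.-integrable [set` j] (EFin \o k) ->
  mu.-integrable [set` i] (EFin \o (k \o T)).
Proof.
move=> mT ij ik.
have := integrable_itv i (integrable_comp mT (integrable_restrict_itv ik)).
apply: eq_integrable => // x; rewrite inE => /ij jx.
by rewrite /= patchE mem_set.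
Qed.

Lemma integrable_wave_powR p Sigma (z0 z1 : R -> R) z f g t : 1 <= p ->
  wave_solution p Sigma z0 z1 z f g -> 0 <= t ->
  [/\ measurable_fun (`]0, 1[ : set (measurableTypeR R)) (fun x => f (t + x)),
      measurable_fun (`]0, 1[ : set (measurableTypeR R)) (fun x => g (t - x)) &
      mu.-integrable `]0, 1[
        (fun x => (`|f (t + x)| `^ p + `|g (t - x)| `^ p)%:E)].
Proof.
move=> p1 [Lf Lg _ _ _] t0.
pose T : R := t + 2; have T0 : 0 < T by rewrite /T; lra.
have T1 : -1 < T by lra.
have [mf iF] := (in_LpP _ p1 (measurable_itv _)).1 (Lf _ T0).
have [mg iG] := (in_LpP _ p1 (measurable_itv _)).1 (Lg _ T1).
have subf : [set` `]0, 1[] `<=` (fun x : R => t + x) @^-1` [set` `]0, T[].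
  by move=> x /=; rewrite !in_itv/= /T => /andP[? ?]; apply/andP; split; lra.
have subg : [set` `]0, 1[] `<=` (fun x : R => t - x) @^-1` [set` `](-1), T[].
  by move=> x /=; rewrite !in_itv/= /T => /andP[? ?]; apply/andP; split; lra.
split.
- apply: (measurable_comp _ _ mf) => //; last exact: measurable_funD.
  by move=> _ [x /subf ? <-].
- apply: (measurable_comp _ _ mg) => //; last exact: measurable_funB.
  by move=> _ [x /subg ? <-].
- have iFt := integrable_comp_itv (measure_preserving_shift t) subf iF.
  have iGt := integrable_comp_itv (measure_preserving_reflection t) subg iG.
  by apply: eq_integrable (integrableD _ iFt iGt).
Qed.

Let wave_sqrt2E (a b : R) :
  (a - b) / Num.sqrt 2 + (a + b) / Num.sqrt 2 = Num.sqrt 2 * a /\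
  (a - b) / Num.sqrt 2 - (a + b) / Num.sqrt 2 = - (Num.sqrt 2 * b).
Proof.
have s0 : Num.sqrt 2 != 0 :> R by rewrite gt_eqF// sqrtr_gt0.
have ss : Num.sqrt 2 * Num.sqrt 2 = 2 :> R by rewrite -expr2 sqr_sqrtr.
move: (Num.sqrt 2) s0 ss => s s0 ss; split.
- by transitivity (2 * a / s); [field|rewrite -ss; field].
- by transitivity (- (2 * b / s)); [field|rewrite -ss; field].
Qed.

Let sqrt2_powR p (y : R) :
  `|Num.sqrt 2 * y| `^ p = 2 `^ (p / 2) * `|y| `^ p.
Proof.
rewrite normrM (ger0_norm (sqrtr_ge0 2)) powRM ?sqrtr_ge0//.
by rewrite -powR12_sqrt// -powRrM [2^-1 * p]mulrC.
Qed.

(** In the characteristic coordinates [z_x + z_t] and [z_x - z_t] the energy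
    splits into the masses of the two travelling waves seen at time [t]. *)
Lemma energyE p Sigma (z0 z1 : R -> R) z f g t : 1 <= p ->
  wave_solution p Sigma z0 z1 z f g -> 0 <= t ->
  energy p z f g t =
  (\int[mu]_(x in `]0, 1[) (`|f (t + x)| `^ p + `|g (t - x)| `^ p)) `^ p^-1.
Proof.
move=> p1 Hz t0; have [wE mw] := wave_is_weak_derivative p1 Hz t0.
have [mf mg ifg] := integrable_wave_powR p1 Hz t0.
rewrite /energy /X_norm; congr (_ `^ _).
pose c : R := 2 `^ (p / 2).
transitivity (2 `^ (- (p / 2)) * \int[mu]_(x in `]0, 1[)
    (c * (`|f (t + x)| `^ p + `|g (t - x)| `^ p))).
  congr (_ * _); rewrite /Rintegral; congr fine.
  have mv : measurable_fun (`]0, 1[ : set (measurableTypeR R)) (wave_t f g t).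
    apply: measurable_funM; last exact: measurable_cst.
    exact: measurable_funD.
  apply: ae_eq_integral => //.
  - apply/measurable_EFinP; apply: measurable_funD;
      apply: (measurableT_comp (measurable_powR _));
      apply: measurableT_comp => //; [exact: measurable_funD|exact: measurable_funB].
  - apply: (measurable_int mu).
    by apply: eq_integrable (integrableZl _ c ifg).
  apply: filterS wE => x /= wx; rewrite in_itv/= => x01; rewrite wx//.
  congr EFin; rewrite /wave_x /wave_t.
  have [-> ->] := wave_sqrt2E (f (t + x)) (g (t - x)).
  by rewrite normrN !sqrt2_powR mulrDr.
rewrite RintegralZl// mulrA -powRD; last by rewrite pnatr_eq0 implybT.
by rewrite addNr powRr0 mul1r.
Qed.

End waves.

(** * Propagation of the singularity *)

Section propagation.
Context {R : realType}.
Local Notation mu := (@lebesgue_measure R).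
Implicit Types (p t x y C : R) (Sigma : set (R * R)) (f g G : R -> R)
  (z : R -> R -> R).

(** Up to the factor [sqrt 2] the coordinates of a boundary state are the sum and
    the difference of the incoming and outgoing waves; if one of them is at most
    [C], the moduli of the two waves differ by at most [C]. *)
Lemma cross_region_reflection C f g t :
  cross_region C (wave_t f g t 1, - wave_x f g t 1) ->
  `|g (t - 1)| - C <= `|f (t + 1)|.
Proof.
have s0 : 0 < Num.sqrt 2 :> R by rewrite sqrtr_gt0.
have nV (a : R) : `|a / Num.sqrt 2| <= C / Num.sqrt 2 -> `|a| <= C.
  by rewrite normrM normfV (gtr0_norm s0) ler_pM2r ?invr_gt0.
rewrite /cross_region/= normrN /wave_t /wave_x => -[] /nV.
- have := ler_normB (f (t + 1) + g (t - 1)) (f (t + 1)).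
  by rewrite addrC addKr; lra.
- have := ler_normB (f (t + 1)) (f (t + 1) - g (t - 1)).
  by rewrite opprB addrC subrK; lra.
Qed.

Section solution.
Variables (p C : R) (Sigma : set (R * R)) (G : R -> R).
Variables (z : R -> R -> R) (f g : R -> R).
Hypotheses (p1 : 1 <= p) (C0 : 0 < C) (G0 : forall x, 0 <= G x).
Hypothesis SigmaC : Sigma `<=` cross_region C.
Hypothesis Hz : wave_solution p Sigma (fun=> 0) (fun x => Num.sqrt 2 * G x) z f g.

(** The data are chosen so that the initial wave is odd with modulus [G]: the same
    singularity is then present on both sides of [0]. *)
Let initial_wave :
  {ae mu, forall y, -1 < y < 1 -> y != 0 -> `|g y| = G `|y| }.
Proof.
have [_ _ _ _ ini] := Hz.
have gN : {ae mu, forall x, 0 < x < 1 -> g (- x) = G x}.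
  have sym := wave_initial_symmetric p1 Hz.
  apply: filterS2 sym ini => x /= fg zx x01.
  have s0 : Num.sqrt 2 != 0 :> R by rewrite gt_eqF// sqrtr_gt0.
  have ss : Num.sqrt 2 * Num.sqrt 2 = 2 :> R by rewrite -expr2 sqr_sqrtr.
  have [_] : z 0 x = 0 /\ wave_t f g 0 x = Num.sqrt 2 * G x.
    by apply: zx; case/andP: x01 => /ltW -> /ltW ->.
  rewrite /wave_t add0r sub0r fg// => /(congr1 (fun r => r * Num.sqrt 2)).
  by rewrite divfK// mulrAC ss; lra.
have gP : {ae mu, forall x, 0 < x < 1 -> g x = - G x}.
  have fg := wave_boundary p1 Hz; have sym := wave_initial_symmetric p1 Hz.
  apply: filterS3 fg sym gN => x /= fg sym gN x01.
  by rewrite -gN// -sym// fg ?opprK//; case/andP: x01.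
have gN' := ae_comp (measure_preserving_reflection 0) gN.
apply: filterS2 gP gN' => y /= gp gn /andP[y0 y1] yn0.
have [y_gt0|y_lt0|y_eq0] := ltgtP 0 y.
- by rewrite gp ?y_gt0// normrN (gtr0_norm y_gt0) ger0_norm.
- have := gn; rewrite sub0r opprK oppr_gt0 y_lt0 => -> //=; last by lra.
  by rewrite (ltr0_norm y_lt0) ger0_norm.
- by rewrite -y_eq0 eqxx in yn0.
Qed.

(** A wave leaving through [t - 1] comes back, reflected at both ends, as the wave
    at [t + 1]. *)
Let one_period :
  {ae mu, forall y, -1 < y -> `|g y| - C <= `|g (2 + y)|}.
Proof.
have [_ _ _ bnd _] := Hz.
have refl : {ae mu, forall t, 0 <= t -> `|g (t - 1)| - C <= `|f (t + 1)|}.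
  apply: filterS bnd => t /= H t0.
  by apply: cross_region_reflection; apply: SigmaC; have [] := H t0.
have refl1 := ae_comp (measure_preserving_shift 1) refl.
have fg2 := ae_comp (measure_preserving_shift 2) (wave_boundary p1 Hz).
apply: filterS2 refl1 fg2 => y /= r1 fg y1.
have := r1; rewrite (_ : 1 + y - 1 = y); last by ring.
rewrite (_ : 1 + y + 1 = 2 + y); last by ring.
by rewrite fg ?normrN; [apply; lra|lra].
Qed.

Let many_periods m :
  {ae mu, forall y, -1 < y -> `|g y| - m%:R * C <= `|g (m%:R * 2 + y)|}.
Proof.
elim: m => [|m IH].
  by apply: aeW => y _; rewrite !mul0r subr0 add0r.
have step := ae_comp (measure_preserving_shift (m%:R * 2)) one_period.
apply: filterS2 IH step => y /= IH step y1.
have m0 : (0 : R) <= m%:R by [].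
have := IH y1; have := step _.
rewrite (_ : 2 + (m%:R * 2 + y) = m.+1%:R * 2 + y); last first.
  by rewrite -natr1; ring.
have -> : m.+1%:R * C = m%:R * C + C by rewrite -natr1; ring.
by move=> /(_ ltac:(lra)) ? ?; lra.
Qed.

Let profile_bound m :
  {ae mu, forall y, -1 < y < 1 -> y != 0 ->
    G `|y| - m%:R * C <= `|g (m%:R * 2 + y)|}.
Proof.
apply: filterS2 initial_wave (many_periods m) => y /= gG per y11 y0.
by rewrite -gG//; apply: per; case/andP: y11.
Qed.

(** After [m] periods the singularity sits at [2 * m], at distance [theta <= 1] from
    [t]. Hence it is visible at time [t] near the point [theta] of [(0, 1)], in [g] if
    [2 * m <= t] and in [f] otherwise. Because it is two-sided, the half of it that
    lies on the side of [theta] with room for [d <= 1 / 2] is entirely visible. *)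
Lemma energy_lower_bound (c d t : R) : 0 <= t -> 0 < d <= 2^-1 ->
  {ae mu, forall x, 0 < x < d -> c <= G x} -> C * (t + 1) <= c ->
  ((c - C * (t + 1)) `^ p * d) `^ p^-1 <= energy p z f g t.
Proof.
move=> t0 /andP[d0 d2] cG Cc; have p0 : 0 < p by exact: lt_le_trans p1.
rewrite (energyE p1 Hz t0).
have [mf mg iQ] := integrable_wave_powR p1 Hz t0.
set K := (c - C * (t + 1)) `^ p.
set Q : R -> R := fun x => `|f (t + x)| `^ p + `|g (t - x)| `^ p.
have K0 : 0 <= K by exact: powR_ge0.
have Q0 x : 0 <= Q x by rewrite addr_ge0 ?powR_ge0.
apply: ge0_ler_powR; rewrite ?nnegrE.
- by rewrite invr_ge0 ltW.
- by rewrite mulr_ge0// ltW.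
- exact: Rintegral_ge0.
(* [2 * m] is an even integer nearest to [t], and [m <= t + 1] *)
have [m /andP[m1]] : exists m : nat, m%:R <= (t + 1) / 2 < m.+1%:R.
  by exists (Num.truncn ((t + 1) / 2)); apply: truncn_itv; lra.
rewrite -[m.+1%:R]natr1 => m2; have m0 : (0 : R) <= m%:R by [].
have Cm : m%:R * C <= C * (t + 1).
  by rewrite mulrC ler_pM2l//; lra.
pose theta : R := `|t - m%:R * 2|.
have tm_ge : -1 <= t - m%:R * 2 by lra.
have tm_le : t - m%:R * 2 <= 1 by lra.
have theta01 : 0 <= theta <= 1 by rewrite normr_ge0/= ler_norml tm_ge tm_le.
have bound : {ae mu, forall x, 0 < x < 1 -> x != theta ->
    C * (t + 1) <= G `|x - theta| -> 
    (G `|x - theta| - C * (t + 1)) `^ p <= Q x}.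
  have powR_le (r s : R) : C * (t + 1) <= r -> r - m%:R * C <= s ->
      (r - C * (t + 1)) `^ p <= s `^ p.
    by move=> ? ?; apply: ge0_ler_powR; rewrite ?nnegrE ?(ltW p0)//; lra.
  have [tm|tm] := leP (m%:R * 2) t.
  - have thE : theta = t - m%:R * 2 by rewrite /theta ger0_norm// subr_ge0.
    have P := ae_comp (measure_preserving_reflection theta) (profile_bound m).
    apply: filterS P => x /= P x01 xth CG.
    apply: (@le_trans _ _ (`|g (t - x)| `^ p)); last by rewrite lerDr powR_ge0.
    apply: powR_le => //.
    have -> : t - x = m%:R * 2 + (theta - x) by rewrite thE; ring.
    rewrite distrC; apply: P; last by rewrite subr_eq0 eq_sym.
    by apply/andP; split; lra.
  - have thE : theta = m%:R * 2 - t.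
      by rewrite /theta ltr0_norm ?subr_lt0// opprB.
    have P := ae_comp (measure_preserving_shift (- theta)) (profile_bound m).
    have fg := ae_comp (measure_preserving_shift t) (wave_boundary p1 Hz).
    apply: filterS2 P fg => x /= P fg x01 xth CG.
    apply: (@le_trans _ _ (`|f (t + x)| `^ p)); last by rewrite lerDl powR_ge0.
    apply: powR_le => //.
    rewrite fg ?normrN; last by lra.
    have -> : t + x = m%:R * 2 + (- theta + x) by rewrite thE; ring.
    rewrite [x - theta]addrC; apply: P; last by rewrite addrC subr_eq0.
    by apply/andP; split; lra.
have [a [a0 ad nearJ]] : exists a : R, [/\ 0 <= a, a + d <= 1 &
    {ae mu, forall x, a < x < a + d -> c <= G `|x - theta| /\ x != theta}].
  have [th2|th2] := leP theta 2^-1.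
  - exists theta; split; [lra|lra|].
    have cGs := ae_comp (measure_preserving_shift (- theta)) cG.
    apply: filterS cGs => x /= cGx /andP[x1 x2]; split; last by rewrite gt_eqF.
    by rewrite gtr0_norm ?subr_gt0// addrC; apply: cGx; apply/andP; split; lra.
  - exists (theta - d); split; [lra|lra|].
    have cGr := ae_comp (measure_preserving_reflection theta) cG.
    apply: filterS cGr => x /= cGx; rewrite subrK => /andP[x1 x2].
    split; last by rewrite lt_eqF.
    by rewrite distrC gtr0_norm ?subr_gt0//; apply: cGx; apply/andP; split; lra.
have J01 (x : R) : a < x < a + d -> 0 < x < 1.
  by move=> /andP[? ?]; apply/andP; split; lra.
pose J : set (measurableTypeR R) := `]a, (a + d)[%classic.
have mJ : measurable J by exact: measurable_itv.
have muJ : mu J = d%:E.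
  by rewrite lebesgue_measure_itv/= lte_fin ltrDl d0 -EFinB addrAC subrr add0r.
have Jsub : J `<=` `]0, 1[%classic.
  by move=> x; rewrite /J/= !in_itv/=; exact: J01.
have intK : (\int[mu]_(x in J) K%:E = (K * d)%:E)%E.
  by rewrite integral_cst// EFinM -muJ.
rewrite -lee_fin -intK /Rintegral fineK; last exact: integrable_fin_num.
apply: (@le_trans _ _ (\int[mu]_(x in J) (Q x)%:E)%E); last first.
  apply: ge0_subset_integral => //.
  - exact: (measurable_int mu iQ).
  - by move=> x _; rewrite lee_fin.
have mQJ : measurable_fun J (EFin \o Q).
  exact: measurable_funS Jsub (measurable_int mu iQ).
apply: ae_ge0_le_integral => //.
- by move=> x _; rewrite lee_fin.
apply: filterS2 bound nearJ => x /= bx nx; rewrite /J/= in_itv/= => xJ.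
have [cx xt] := nx xJ; rewrite lee_fin.
apply: le_trans (bx (J01 _ xJ) xt _); last exact: le_trans cx.
by apply: ge0_ler_powR; rewrite ?nnegrE ?(ltW p0)//; lra.
Qed.

End solution.
End propagation.

(** * Arbitrarily slow decay *)

Lemma zero_in_W1p_star (R : realType) (p : R) : 1 <= p ->
  in_W1p_star p (fun=> 0 : R).
Proof.
move=> p1.
have L0 : in_Lp p `]0, 1[ (fun=> 0 : R).
  apply/in_LpP => //; split; first exact: measurable_cst.
  have p0 : p != 0 by rewrite gt_eqF// (lt_le_trans _ p1).
  by apply: eq_integrable (integrable0 _ _) => // x _; rewrite /= normr0 powR0.
have i0 : lebesgue_measure.-integrable setT (EFin \o (fun=> 0 : R)).
  exact: integrable0.
split=> //.
- exists (fun=> 0) => //.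
  apply: (is_weak_derivative_primitive (c := 0)) => // x _.
  by rewrite add0r /primitive /Rintegral integral0.
- exists (fun=> 0); split => //; last exact: aeW.
  by apply: continuous_subspaceT; exact: cst_continuous.
Qed.

Theorem theorem59 (R : realType) (Sigma : set (R * R)) (C : R)
    (HSigma : damping_set Sigma) (HC : 0 < C)
    (HSigmaC : Sigma `<=` cross_region C)
    (p : R) (Hp : 1 <= p) (varphi : R -> R)
    (Hpos : forall t : R, 0 <= t -> 0 < varphi t)
    (Hdecr : forall s t : R, 0 <= s -> s <= t -> varphi t <= varphi s)
    (Hlim : varphi t @[t --> +oo] --> (0 : R)) :
  exists z0 z1 : R -> R,
    in_X p z0 z1 /\
    forall (z : R -> R -> R) (f g : R -> R),
      wave_solution p Sigma z0 z1 z f g ->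
      forall t : R, 0 <= t -> varphi t <= energy p z f g t.
Proof.
have [G [G0 LG Gslow]] := slow_profile Hp HC Hpos Hdecr Hlim.
exists (fun=> 0), (fun x => Num.sqrt 2 * G x); split.
  split; first exact: zero_in_W1p_star.
  apply/in_LpP => //.
  have [mG iG] := (in_LpP _ Hp (measurable_itv _)).1 LG.
  split; first by apply: measurable_funM => //; exact: measurable_cst.
  apply: eq_integrable (integrableZl _ (`|Num.sqrt 2| `^ p) iG) => // x _.
  by rewrite /= normrM powRM.
move=> z f g Hz t t0; have p0 : 0 < p by exact: lt_le_trans Hp.
have [c [d [d01 cG Cc phid]]] := Gslow t t0.
apply: le_trans (energy_lower_bound Hp HC G0 HSigmaC Hz t0 d01 cG Cc).
have -> : varphi t = (varphi t `^ p) `^ p^-1.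
  by rewrite -powRrM mulfV ?gt_eqF// powRr1// ltW// Hpos.
have d0 : 0 <= d by case/andP: d01 => /ltW.
by apply: ge0_ler_powR; rewrite ?nnegrE ?invr_ge0 ?(ltW p0)// ?mulr_ge0 ?powR_ge0.
Qed.
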